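(* Let $\mathbb{W}$ be a union of lines and ACM points in $\mathbb{P}^1\times\mathbb{P}^1$ and let $\mathcal{G}(I_{\mathbb{W}})$ be its standard generating set. Then for any nonempty subset $S\subseteq\mathcal{G}(I_{\mathbb{W}})$, the ideal $\langle S\rangle$ is the defining ideal of a union of lines and ACM points (allowing the cases where it consists only of lines or only of points).
   Context: $R=\mathbb{C}[x_0,x_1,y_0,y_1]$ is bigraded with $\deg x_i=(1,0)$, $\deg y_i=(0,1)$. For $A=[a_0:a_1]\in\mathbb{P}^1$ let $H_A=a_1x_0-a_0x_1$ and for $B=[b_0:b_1]$ let $V_B=b_1y_0-b_0y_1$; the same symbol denotes the form and its zero set (horizontal, resp. vertical, line or ruling). $I_{A\times B}=\langle H_A,V_B\rangle$, $I_{\mathbb{X}}=\bigcap_{P\in\mathbb{X}}I_P$, and a finite set $\mathbb{X}$ is ACM if $R/I_{\mathbb{X}}$ is Cohen–Macaulay. A union of lines and points is $\mathbb{W}=\{P_1,\dots,P_r,H_1,\dots,H_t,V_1,\dots,V_p\}$ (distinct points, horizontal lines and vertical lines, no point on any of the lines), with $\mathbb{X}_{\mathbb{W}}=\{P_1,\dots,P_r\}$ and $I_{\mathbb{W}}=\bigcap_iI_{P_i}\cap\bigcap_i\langle H_i\rangle\cap\bigcap_j\langle V_j\rangle$; it is a union of lines and ACM points if $\mathbb{X}_{\mathbb{W}}$ is ACM. For ACM $\mathbb{X}$ with $\pi_1(\mathbb{X})=\{A_1,\dots,A_h\}$, $\pi_2(\mathbb{X})=\{B_1,\dots,B_v\}$,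 labelled so that $\alpha_i=|\{P\in\mathbb{X}:P\in H_{A_i}\}|$ satisfies $\alpha_1\ge\cdots\ge\alpha_h$ and the counts on $V_{B_j}$ are nonincreasing, $I_{\mathbb{X}}$ is minimally generated by $\{H_{A_1}\cdots H_{A_h},\ V_{B_1}\cdots V_{B_v}\}\cup\{H_{A_1}\cdots H_{A_i}V_{B_1}\cdots V_{B_{\alpha_{i+1}}}:\alpha_{i+1}<\alpha_i\}$ (unique up to nonzero scalars). The standard generating set of $I_{\mathbb{W}}$ is this set for $\mathbb{X}=\mathbb{X}_{\mathbb{W}}$, each element multiplied by $\Lambda=\prod_iH_i\prod_jV_j$ (and $\{\Lambda\}$ if $\mathbb{X}_{\mathbb{W}}=\emptyset$); it is a minimal generating set of $I_{\mathbb{W}}$. *)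

(* Defs.v *)
From mathcomp Require Import all_boot all_algebra.
From mathcomp Require Import complex.
From mathcomp Require Import Rstruct.
From mathcomp Require Import mpoly.

Set Implicit Arguments.
Unset Strict Implicit.
Unset Printing Implicit Defensive.

Import GRing.Theory.
Local Open Scope ring_scope.

Definition CC : closedFieldType := (Rdefinitions.R)[i].

Notation poly4 := {mpoly CC[4]}.

Definition x0 : poly4 := 'X_(@Ordinal 4 0 isT).
Definition x1 : poly4 := 'X_(@Ordinal 4 1 isT).
Definition y0 : poly4 := 'X_(@Ordinal 4 2 isT).
Definition y1 : poly4 := 'X_(@Ordinal 4 3 isT).

(* A point [a0:a1] of P^1 is represented by a pair (a0,a1) with (a0,a1) != 0;
   two pairs represent the same projective point iff P1eq holds. *)
Definition P1 := (CC * CC)%type.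
Definition P1ok (a : P1) : bool := (a.1 != 0) || (a.2 != 0).
Definition P1eq (a b : P1) : bool := a.1 * b.2 == a.2 * b.1.

Definition pt := (P1 * P1)%type.
Definition ptok (P : pt) : bool := P1ok P.1 && P1ok P.2.
Definition pteq (P Q : pt) : bool := P1eq P.1 Q.1 && P1eq P.2 Q.2.

Definition HA (a : P1) : poly4 := a.2 *: x0 - a.1 *: x1.
Definition VB (b : P1) : poly4 := b.2 *: y0 - b.1 *: y1.

(* The point P = A x B lies on the horizontal line H_C iff H_C(A) = 0,
   i.e. A = C in P^1; it lies on the vertical line V_D iff B = D. *)
Definition on_H (c : P1) (P : pt) : bool := P1eq P.1 c.
Definition on_V (d : P1) (P : pt) : bool := P1eq P.2 d.

Definition gen_ideal (s : seq poly4) : poly4 -> Prop :=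
  fun f => exists c : 'I_(size s) -> poly4, f = \sum_(i < size s) c i * s`_i.

Definition I_pt (P : pt) : poly4 -> Prop := gen_ideal [:: HA P.1; VB P.2].

(* I_X = intersection of the I_P, P in X (the whole ring if X is empty). *)
Definition I_pts (X : seq pt) : poly4 -> Prop :=
  fun f => forall P, P \in X -> I_pt P f.

Definition I_W (X : seq pt) (Hs Vs : seq P1) : poly4 -> Prop :=
  fun f => I_pts X f /\
           (forall a, a \in Hs -> gen_ideal [:: HA a] f) /\
           (forall b, b \in Vs -> gen_ideal [:: VB b] f).

Definition lines_points_ok (X : seq pt) (Hs Vs : seq P1) : Prop :=
  all ptok X /\ all P1ok Hs /\ all P1ok Vs /\
  pairwise (fun P Q => ~~ pteq P Q) X /\
  pairwise (fun a b => ~~ P1eq a b) Hs /\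
  pairwise (fun a b => ~~ P1eq a b) Vs /\
  (forall P, P \in X ->
        (forall a, a \in Hs -> ~~ on_H a P) /\
        (forall b, b \in Vs -> ~~ on_V b P)).

Definition is_ideal (J : poly4 -> Prop) : Prop :=
  [/\ J 0, (forall f g, J f -> J g -> J (f + g)) & (forall r f, J f -> J (r * f))].

Definition prime_ideal (J : poly4 -> Prop) : Prop :=
  [/\ is_ideal J, ~ J 1 & (forall f g, J (f * g) -> J f \/ J g)].

Definition ideal_add (I : poly4 -> Prop) (s : seq poly4) : poly4 -> Prop :=
  fun f => exists g h, [/\ I g, gen_ideal s h & f = g + h].

Definition max_ideal : poly4 -> Prop := gen_ideal [:: x0; x1; y0; y1].

Definition regular_seq (I : poly4 -> Prop) (s : seq poly4) : Prop :=
  (forall i, (i < size s)%N ->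
     max_ideal s`_i /\
     (forall g, ideal_add I (take i s) (g * s`_i) -> ideal_add I (take i s) g))
  /\ ~ ideal_add I s 1.

Definition depth_eq (I : poly4 -> Prop) (d : nat) : Prop :=
  (exists s, size s = d /\ regular_seq I s) /\
  (forall s, regular_seq I s -> (size s <= d)%N).

Definition prime_chain (I : poly4 -> Prop) (n : nat) (P : nat -> poly4 -> Prop) : Prop :=
  (forall i, (i <= n)%N -> prime_ideal (P i) /\ (forall f, I f -> P i f)) /\
  (forall i, (i < n)%N ->
     (forall f, P i f -> P i.+1 f) /\ (exists f, P i.+1 f /\ ~ P i f)).

Definition krull_dim_eq (I : poly4 -> Prop) (d : nat) : Prop :=
  (exists P, prime_chain I d P) /\
  (forall n P, prime_chain I n P -> (n <= d)%N).

(* R/I is Cohen-Macaulay (I bihomogeneous, hence homogeneous: CM iff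
   depth_m(R/I) = dim R/I). *)
Definition CM_quot (I : poly4 -> Prop) : Prop :=
  exists d, krull_dim_eq I d /\ depth_eq I d.

(* X is ACM: R/I_X is Cohen-Macaulay; the empty set (R/I_X = 0) counts as ACM. *)
Definition ACM (X : seq pt) : Prop := X = [::] \/ CM_quot (I_pts X).

Definition alpha (X : seq pt) (a : P1) : nat := count (on_H a) X.
Definition beta (X : seq pt) (b : P1) : nat := count (on_V b) X.

Definition labelling_ok (X : seq pt) (As Bs : seq P1) : Prop :=
  all P1ok As /\ all P1ok Bs /\
  pairwise (fun a b => ~~ P1eq a b) As /\
  pairwise (fun a b => ~~ P1eq a b) Bs /\
  (forall P, P \in X -> has (P1eq P.1) As /\ has (P1eq P.2) Bs) /\
  (forall a, a \in As -> has (fun P : pt => P1eq P.1 a) X) /\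
  (forall b, b \in Bs -> has (fun P : pt => P1eq P.2 b) X) /\
  sorted (fun m n => (n <= m)%N) (map (alpha X) As) /\
  sorted (fun m n => (n <= m)%N) (map (beta X) Bs).

Definition prodH (As : seq P1) (i : nat) : poly4 := \prod_(a <- take i As) HA a.
Definition prodV (Bs : seq P1) (k : nat) : poly4 := \prod_(b <- take k Bs) VB b.

(* Minimal generators of I_X:
   H_{A_1}..H_{A_h}, V_{B_1}..V_{B_v}, and, for 1 <= i <= h-1 with
   alpha_{i+1} < alpha_i, H_{A_1}..H_{A_i} V_{B_1}..V_{B_{alpha_{i+1}}}.
   (0-indexed: al j = alpha of As`_j.) *)
Definition gens_pts (X : seq pt) (As Bs : seq P1) : seq poly4 :=
  let al := fun j => alpha X (nth (0, 0) As j) in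
  [:: prodH As (size As); prodV Bs (size Bs)] ++
  [seq prodH As i * prodV Bs (al i) | i <- iota 1 (size As).-1 & (al i < al i.-1)%N].

Definition Lambda (Hs Vs : seq P1) : poly4 :=
  (\prod_(a <- Hs) HA a) * (\prod_(b <- Vs) VB b).

Definition std_gens (X : seq pt) (Hs Vs As Bs : seq P1) : seq poly4 :=
  if X is [::] then [:: Lambda Hs Vs]
  else [seq Lambda Hs Vs * g | g <- gens_pts X As Bs].

(* Main.v *)
(* Every standard generator has the form Lambda H_1...H_i V_1...V_j, so S is given
   by a finite nonempty set D of pairs (i, j); let a and b be the least i and j
   occurring. After removing the common factor Lambda H_1...H_a V_1...V_b, the
   ideal <S> is built row by row as H_k J' + (V_(b+1)...V_mu(k)), where mu(k) is the
   least j over the pairs with i <= k, and such an ideal is the ideal of the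
   staircase of the points A_k x B_j with k > a and b < j <= mu(k).
   For a staircase X, linear forms H_C and V_D through no point of X form a regular
   sequence on R/I_X. Conversely depth and dimension are at most 2: any three
   polynomials are algebraically dependent modulo I_X, and the lowest term of a relation rules
   out three successive nonzerodivisors. *)

Require Import Defs.
From HB Require Import structures.
From mathcomp Require Import all_boot all_algebra.
From mathcomp Require Import complex.
From mathcomp Require Import Rstruct.
From mathcomp Require Import mpoly.
From mathcomp Require Import ring zify.

Import GRing.Theory.
Local Open Scope ring_scope.

Local Notation o0 := (@Ordinal 4 0 isT).
Local Notation o1 := (@Ordinal 4 1 isT).
Local Notation o2 := (@Ordinal 4 2 isT).
Local Notation o3 := (@Ordinal 4 3 isT).

(* The notions of Defs.v are restated over an arbitrary ring or field: over the
   concrete field [CC], unification unfolds the construction of the reals. *)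

Section Ideals.
Context {A : comNzRingType}.
Implicit Types (s : seq A) (I J : A -> Prop) (f g h : A).

Definition igen s : A -> Prop :=
  fun f => exists c : 'I_(size s) -> A, f = \sum_(i < size s) c i * s`_i.

Definition ideal J : Prop :=
  [/\ J 0, (forall f g, J f -> J g -> J (f + g)) & (forall r f, J f -> J (r * f))].

Definition prime_id J : Prop :=
  [/\ ideal J, ~ J 1 & (forall f g, J (f * g) -> J f \/ J g)].

Definition add_igen I s : A -> Prop :=
  fun f => exists g h, [/\ I g, igen s h & f = g + h].

Definition regular (m I : A -> Prop) s : Prop :=
  (forall i, (i < size s)%N ->
     m s`_i /\
     (forall g, add_igen I (take i s) (g * s`_i) -> add_igen I (take i s) g))
  /\ ~ add_igen I s 1.

Definition chain I (n : nat) (P : nat -> A -> Prop) : Prop :=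
  (forall i, (i <= n)%N -> prime_id (P i) /\ (forall f, I f -> P i f)) /\
  (forall i, (i < n)%N ->
     (forall f, P i f -> P i.+1 f) /\ (exists f, P i.+1 f /\ ~ P i f)).

Lemma igen1 g f : igen [:: g] f <-> exists h, f = h * g.
Proof.
split=> [[c ->]|[h ->]]; first by exists (c ord0); rewrite big_ord1.
by exists (fun=> h); rewrite big_ord1.
Qed.

Lemma igen_nil f : igen [::] f <-> f = 0.
Proof.
split=> [[c ->]|->]; first by rewrite big_ord0.
by exists (fun=> 0); rewrite big_ord0.
Qed.

Lemma igen_cons g s f : igen (g :: s) f <-> exists c h, igen s h /\ f = c * g + h.
Proof.
split=> [[c ->]|[c [_ [[d ->] ->]]]].
  rewrite big_ord_recl; exists (c ord0), (\sum_(i < size s) c (lift ord0 i) * s`_i).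
  by split=> //; exists (fun i => c (lift ord0 i)).
exists (fun i : 'I_(size s).+1 => if unlift ord0 i is Some j then d j else c).
rewrite big_ord_recl unlift_none; congr (_ + _).
by apply: eq_bigr => i _; rewrite liftK.
Qed.

Lemma igen_ideal s : ideal (igen s).
Proof.
split=> [|f g [c ->] [d ->]|r f [c ->]].
- by exists (fun=> 0); rewrite big1 // => i _; rewrite mul0r.
- by exists (fun i => c i + d i); rewrite -big_split; apply: eq_bigr => i _; rewrite mulrDl.
- by exists (fun i => r * c i); rewrite mulr_sumr; apply: eq_bigr => i _; rewrite mulrA.
Qed.

Lemma ideal_sum J (T : Type) (r : seq T) (P : pred T) (G : T -> A) :
  ideal J -> (forall i, P i -> J (G i)) -> J (\sum_(i <- r | P i) G i).
Proof. by case=> J0 JD _ JG; elim/big_ind: _. Qed.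

Lemma mem_igen s f : f \in s -> igen s f.
Proof.
elim: s => // g s IH; rewrite inE => fgs; apply/igen_cons.
case/orP: fgs => [/eqP->|/IH fs]; last by exists 0, f; rewrite mul0r add0r.
by exists 1, 0; rewrite mul1r addr0; split=> //; case: (igen_ideal s).
Qed.

Lemma igen_sub s J f : ideal J -> {in s, forall g, J g} -> igen s f -> J f.
Proof.
move=> Ji sJ [c ->]; apply: ideal_sum => // i _.
by case: Ji => _ _; apply; apply/sJ/mem_nth.
Qed.

Lemma add_igen_ideal I s : ideal I -> ideal (add_igen I s).
Proof.
case=> I0 ID IM; have [S0 SD SM] := igen_ideal s; split.
- by exists 0, 0; rewrite addr0.
- move=> f g [f1 [f2 [If Sf ->]]] [g1 [g2 [Ig Sg ->]]]; exists (f1 + g1), (f2 + g2).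
  by rewrite addrACA; split; [apply: ID|apply: SD|].
- move=> r f [f1 [f2 [If Sf ->]]]; exists (r * f1), (r * f2).
  by rewrite mulrDr; split; [apply: IM|apply: SM|].
Qed.

Lemma add_igen_sub I s J f : ideal J -> (forall g, I g -> J g) ->
  {in s, forall g, J g} -> add_igen I s f -> J f.
Proof.
move=> Ji IJ sJ [g [h [/IJ Jg Sh ->]]].
by case: (Ji) => _ + _; apply; last exact: igen_sub Sh.
Qed.

Lemma add_igen_l I s f : I f -> add_igen I s f.
Proof. by move=> If; exists f, 0; rewrite addr0; split=> //; case: (igen_ideal s). Qed.

Lemma add_igen_r I s f : ideal I -> igen s f -> add_igen I s f.
Proof. by case=> I0 _ _ Sf; exists 0, f; rewrite add0r. Qed.

Lemma add_igen1 I l f :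
  add_igen I [:: l] f <-> exists g e, I g /\ f = g + e * l.
Proof.
split=> [[g [h [Ig /igen1[e ->] ->]]]|[g [e [Ig ->]]]]; first by exists g, e.
by exists g, (e * l); split=> //; apply/igen1; exists e.
Qed.

End Ideals.

Lemma kernel_prime {A : comNzRingType} {D : idomainType} (u : {rmorphism A -> D}) :
  prime_id (fun f => u f = 0).
Proof.
split; first split=> [|f g fu gu|r f fu].
- exact: rmorph0.
- by rewrite rmorphD fu gu addr0.
- by rewrite rmorphM fu mulr0.
- by move/eqP; rewrite rmorph1 oner_eq0.
- by move=> f g /eqP; rewrite rmorphM mulf_eq0 => /orP[] /eqP; [left|right].
Qed.

Section Substitution.
Context {R : comNzRingType}.

Definition msubst {n k : nat} (s : 'I_n -> {mpoly R[k]}) (f : {mpoly R[n]}) :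
  {mpoly R[k]} := f \mPo [tuple s i | i < n].

HB.instance Definition _ n k (s : 'I_n -> {mpoly R[k]}) :=
  GRing.RMorphism.copy (msubst s) (comp_mpoly [tuple s i | i < n]).

HB.instance Definition _ n k (s : 'I_n -> {mpoly R[k]}) :=
  GRing.Linear.copy (msubst s) (comp_mpoly [tuple s i | i < n]).

Lemma msubstX {n k} (s : 'I_n -> {mpoly R[k]}) i : msubst s 'X_i = s i.
Proof. by rewrite /msubst comp_mpolyXU -tnth_nth tnth_mktuple. Qed.

Lemma msubst_comp {n k l} (s : 'I_n -> {mpoly R[k]}) (t : 'I_k -> {mpoly R[l]}) f :
  msubst t (msubst s f) = msubst (fun i => msubst t (s i)) f.
Proof.
elim/mpolyind: f => [|c m f _ _ IH]; first by rewrite !rmorph0.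
rewrite !rmorphD /= IH; congr (_ + _).
rewrite !linearZ /=; congr (_ *: _).
rewrite mpolyXE_id !rmorph_prod /=; apply: eq_bigr => i _.
by rewrite !rmorphXn /= !msubstX.
Qed.

Lemma eq_msubst {n k} {s t : 'I_n -> {mpoly R[k]}} f : s =1 t -> msubst s f = msubst t f.
Proof.
by move=> st; rewrite /msubst; congr (f \mPo _); apply: eq_from_tnth => i; rewrite !tnth_mktuple.
Qed.

Lemma msubst_congr {n} (J : {mpoly R[n]} -> Prop) (s : 'I_n -> {mpoly R[n]}) f :
  ideal J -> (forall i, J ('X_i - s i)) -> J (f - msubst s f).
Proof.
case=> J0 JD JM Js.
pose Q (g : {mpoly R[n]}) := J (g - msubst s g).
have QM g h : Q g -> Q h -> Q (g * h).
  rewrite /Q rmorphM => Qg Qh.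
  have -> : g * h - msubst s g * msubst s h =
     h * (g - msubst s g) + msubst s g * (h - msubst s h) by ring.
  by apply: JD; apply: JM.
have Q1 : Q 1 by rewrite /Q rmorph1 subrr.
suff : Q f by [].
elim/mpolyind: f => [|c m f _ _ IH]; first by rewrite /Q rmorph0 subrr.
rewrite /Q rmorphD /= opprD addrACA; apply: JD => //.
rewrite linearZ /= -scalerBr -mul_mpolyC; apply: JM.
suff : Q 'X_[m] by [].
rewrite mpolyXE_id; elim/big_ind: _ => // i _.
elim: (m i) => [|e IHe]; first by rewrite expr0.
by rewrite exprS; apply: QM => //; rewrite /Q msubstX.
Qed.

End Substitution.

Section LinearForms.
Context {F : fieldType} {n : nat}.
Implicit Types (a b : F * F) (i j k l : 'I_n).

Definition nz a : bool := (a.1 != 0) || (a.2 != 0).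
Definition same a b : bool := a.1 * b.2 == a.2 * b.1.

Definition lin i j a : {mpoly F[n]} := a.2 *: 'X_i - a.1 *: 'X_j.

(* The form [lin i j (dual a)] takes the value 1 at [a]. *)
Definition dual a : F * F := if a.1 != 0 then (0, a.1^-1) else (- a.2^-1, 0).

Lemma dualP a : nz a -> (dual a).2 * a.1 - (dual a).1 * a.2 = 1.
Proof.
rewrite /nz /dual; have [a1|a1 /= a2] := altP (a.1 =P 0); last by rewrite mulVf // mul0r subr0.
by move=> /= a2; rewrite mul0r sub0r mulNr opprK mulVf.
Qed.

Lemma dual_nz {a} : nz a -> nz (dual a).
Proof.
rewrite /nz /dual; have [a1 /= a2|a1 /= _] := altP (a.1 =P 0).
  by rewrite oppr_eq0 invr_eq0 a2.
by rewrite invr_eq0 a1 orbT.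
Qed.

Definition kill i j a : {mpoly F[n]} -> {mpoly F[n]} :=
  msubst (fun k => if k == i then a.1 *: lin i j (dual a)
                   else if k == j then a.2 *: lin i j (dual a) else 'X_k).
HB.instance Definition _ i j a := GRing.RMorphism.on (kill i j a).
HB.instance Definition _ i j a := GRing.Linear.on (kill i j a).

Lemma lin_neq0 i j a : i != j -> nz a -> lin i j a != 0.
Proof.
move=> ij; apply: contraTN => /eqP E.
have Ei : (lin i j a)@_(U_(i)%MM) = 0 by rewrite E mcoeff0.
have Ej : (lin i j a)@_(U_(j)%MM) = 0 by rewrite E mcoeff0.
move: Ei Ej; rewrite /lin !mcoeffB !mcoeffZ !mcoeffX !eqxx.
rewrite !eq_mnm1 [j == i]eq_sym (negPf ij).
rewrite !mulr0 !mulr1 subr0 sub0r => a2 /eqP; rewrite oppr_eq0 => a1.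
by rewrite /nz a1 a2 eqxx.
Qed.

Lemma kill_lin i j a b : i != j ->
  kill i j a (lin i j b) = (b.2 * a.1 - b.1 * a.2) *: lin i j (dual a).
Proof.
move=> ij; rewrite {1}/lin linearB !linearZ /= /kill !msubstX eqxx.
rewrite [j == i]eq_sym (negPf ij) ?eqxx !scalerA.
by rewrite scalerN scalerA scalerBl.
Qed.

Lemma kill_lin_neq0 i j a b : i != j -> nz a ->
  (kill i j a (lin i j b) != 0) = ~~ same a b.
Proof.
move=> ij oka; rewrite kill_lin // scaler_eq0 negb_or lin_neq0 ?dual_nz // andbT.
by rewrite subr_eq0 /same mulrC [b.1 * _]mulrC.
Qed.

Lemma kill_self i j a : i != j -> kill i j a (lin i j a) = 0.
Proof. by move=> ij; rewrite kill_lin // mulrC subrr scale0r. Qed.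

Lemma kill_other i j a k l b : k != i -> k != j -> l != i -> l != j ->
  kill i j a (lin k l b) = lin k l b.
Proof.
move=> ki kj li lj; rewrite {1}/lin linearB !linearZ /= /kill !msubstX.
by rewrite (negPf ki) (negPf kj) (negPf li) (negPf lj) scalerN.
Qed.

Lemma kill_congr i j a f : i != j -> nz a -> exists g, f - kill i j a f = g * lin i j a.
Proof.
move=> ij oka; apply/igen1; apply: msubst_congr; first exact: igen_ideal.
have E := dualP _ oka; move=> k; apply/igen1.
have E1 : ((dual a).2%:MP * a.1%:MP - (dual a).1%:MP * a.2%:MP) = 1 :> {mpoly F[n]}.
  by rewrite -!rmorphM -rmorphB E rmorph1.
have [->|ki] := eqVneq k i.
  exists (- (dual a).1%:MP); rewrite -[X in X - _]mul1r -E1 /lin -!mul_mpolyC.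
  by ring.
have [->|kj] := eqVneq k j; last by exists 0; rewrite subrr mul0r.
exists (- (dual a).2%:MP); rewrite -[X in X - _]mul1r -E1 /lin -!mul_mpolyC.
by ring.
Qed.

Lemma killP i j a f : i != j -> nz a ->
  igen [:: lin i j a] f <-> kill i j a f = 0.
Proof.
move=> ij oka; rewrite igen1; split=> [[h ->]|E].
  by rewrite rmorphM /= kill_self // mulr0.
by have [g] := kill_congr i j a f ij oka; rewrite E subr0; exists g.
Qed.

End LinearForms.

Section ProductsOfForms.
Context {F : fieldType} {n : nat} (i j : 'I_n) (ij : i != j).
Implicit Types (a b : F * F) (s : seq (F * F)) (f g u w : {mpoly F[n]}).

Lemma same_sym a b : same a b = same b a.
Proof. by rewrite /same eq_sym mulrC [a.1 * _]mulrC. Qed.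

Definition linprod s : {mpoly F[n]} := \prod_(a <- s) lin i j a.

Lemma linprod_cons a s : linprod (a :: s) = lin i j a * linprod s.
Proof. exact: big_cons. Qed.

Lemma linprod_cat s t : linprod (s ++ t) = linprod s * linprod t.
Proof. exact: big_cat. Qed.

Lemma linprod_take k m s : (k <= m)%N ->
  exists c, linprod (take m s) = c * linprod (take k s).
Proof.
move=> km; exists (linprod (drop k (take m s))).
by rewrite -{1}(cat_take_drop k (take m s)) linprod_cat take_takel // mulrC.
Qed.

Lemma linprod_mem a s : a \in s -> exists c, linprod s = c * lin i j a.
Proof.
move=> /path.splitPr[s1 s2]; exists (linprod s1 * linprod s2).
by rewrite linprod_cat linprod_cons mulrCA mulrC.
Qed.

Lemma linprod_dvd s f : all nz s -> pairwise (fun a b => ~~ same a b) s ->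
  (forall a, a \in s -> igen [:: lin i j a] f) -> exists g, f = g * linprod s.
Proof.
elim: s f => [|a s IH] f /=; first by exists f; rewrite /linprod big_nil mulr1.
case/andP=> nza nzs /andP[/allP as_ ps] sf.
have [h fE] : exists h, f = h * lin i j a by apply/igen1/sf; rewrite mem_head.
have [|g hE] := IH h nzs ps; last by exists g; rewrite fE hE linprod_cons mulrAC mulrA.
move=> b bs; have nzb := allP nzs b bs.
have : igen [:: lin i j b] f by apply: sf; rewrite inE bs orbT.
rewrite !killP // fE rmorphM /= => /eqP; rewrite mulf_eq0 => /orP[/eqP //|].
by move/negPn; rewrite kill_lin_neq0 // same_sym as_.
Qed.

Lemma linprod_coprime s u w g : all nz s -> (forall a, a \in s -> kill i j a u != 0) ->
  u * w = g * linprod s -> exists h, w = h * linprod s.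
Proof.
elim: s w g => [|a s IH] w g /=; first by exists w; rewrite /linprod big_nil mulr1.
case/andP=> nza nzs us; rewrite linprod_cons => E.
have [h wE] : exists h, w = h * lin i j a.
  apply/igen1; rewrite killP //; apply/eqP; have := congr1 (kill i j a) E.
  rewrite !rmorphM /= kill_self // mul0r mulr0 => /eqP.
  by rewrite mulf_eq0 (negPf (us a _)) ?mem_head.
have us' b : b \in s -> kill i j b u != 0 by move=> bs; apply: us; rewrite inE bs orbT.
have E' : u * h = g * linprod s.
  apply: (mulIf (lin_neq0 i j a ij nza)); rewrite -mulrA -wE E.
  by rewrite -mulrA [linprod s * _]mulrC.
by have [k hE] := IH h g nzs us' E'; exists k; rewrite wE hE mulrAC mulrA.
Qed.

Lemma linprod_neq0 s : all nz s -> linprod s != 0.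
Proof.
elim: s => [|a s IH] /=; first by rewrite /linprod big_nil oner_neq0.
by case/andP=> nza nzs; rewrite linprod_cons mulf_neq0 ?IH // lin_neq0.
Qed.

End ProductsOfForms.

Section Staircase.
Context {F : fieldType}.
Local Notation T := {mpoly F[4]}.
Implicit Types (a b c d : F * F) (P : (F * F) * (F * F)) (f g u w : T).

Definition hform a : T := lin o0 o1 a.
Definition vform b : T := lin o2 o3 b.
Definition hprod s : T := linprod o0 o1 s.
Definition vprod s : T := linprod o2 o3 s.
Definition killH a : T -> T := kill o0 o1 a.
Definition killV b : T -> T := kill o2 o3 b.
HB.instance Definition _ a := GRing.RMorphism.on (killH a).
HB.instance Definition _ a := GRing.Linear.on (killH a).
HB.instance Definition _ a := GRing.RMorphism.on (killV a).
HB.instance Definition _ a := GRing.Linear.on (killV a).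

Definition nz2 P := nz P.1 && nz P.2.
Definition vanish_at P : T -> Prop := igen [:: hform P.1; vform P.2].
Definition vanish (X : seq ((F * F) * (F * F))) : T -> Prop :=
  fun f => forall P, P \in X -> vanish_at P f.

Lemma killH_vform a b : killH a (vform b) = vform b.
Proof. exact: kill_other. Qed.

Lemma killV_hform a b : killV b (hform a) = hform a.
Proof. exact: kill_other. Qed.

Lemma killH_vprod a s : killH a (vprod s) = vprod s.
Proof. by rewrite rmorph_prod; apply: eq_bigr => b _; apply: killH_vform. Qed.

Lemma vanish_atP P f : nz2 P -> vanish_at P f <-> killV P.2 (killH P.1 f) = 0.
Proof.
case/andP=> nzH nzV; split.
  apply: (igen_sub _ (fun g => killV P.2 (killH P.1 g) = 0)) => [|g].
    split=> [|g h|r g]; rewrite ?rmorph0 // ?rmorphD ?rmorphM /=.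
      by move=> -> ->; rewrite addr0.
    by move=> ->; rewrite mulr0.
  rewrite !inE => /orP[]/eqP->; first by rewrite /killH kill_self // rmorph0.
  by rewrite killH_vform /killV kill_self.
move=> E; have [g gE] := kill_congr o0 o1 P.1 f isT nzH.
have [h hE] := kill_congr o2 o3 P.2 (killH P.1 f) isT nzV.
apply/igen_cons; exists g, (killH P.1 f); split; last first.
  by rewrite -gE subrK.
by apply/igen1; exists h; rewrite -hE -/(killV _ _) E subr0.
Qed.

Lemma vanish_at_ideal P : ideal (vanish_at P).
Proof. exact: igen_ideal. Qed.

Lemma vanish_ideal X : ideal (vanish X).
Proof.
split=> [P _|f g If Ig P PX|r f If P PX]; case: (vanish_at_ideal P) => I0 ID IM //.
  by apply: ID; [apply: If|apply: Ig].
by apply: IM; apply: If.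
Qed.

Lemma vanish_atM P f g : nz2 P -> vanish_at P (f * g) -> ~ vanish_at P f -> vanish_at P g.
Proof.
move=> nzP; rewrite !vanish_atP // !rmorphM /= => /eqP.
by rewrite mulf_eq0 => /orP[/eqP->|/eqP->].
Qed.

Lemma vanish_at_hform P a : nz2 P -> vanish_at P (hform a) <-> same P.1 a.
Proof.
move=> nzP; rewrite vanish_atP //; have [nzH _] := andP nzP.
rewrite /killH /hform kill_lin // linearZ /= -/(hform _) killV_hform.
have := lin_neq0 o0 o1 _ isT (dual_nz nzH); rewrite -/(hform _) => /negPf n0.
rewrite (rwP eqP) scaler_eq0 n0 orbF subr_eq0 /same.
by rewrite mulrC [a.1 * _]mulrC.
Qed.

Lemma vanish_at_vform P b : nz2 P -> vanish_at P (vform b) <-> same P.2 b.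
Proof.
move=> nzP; rewrite vanish_atP // killH_vform; have [_ nzV] := andP nzP.
rewrite (rwP eqP) -[same _ _]negbK -[_ == 0]negbK.
by rewrite /killV /vform kill_lin_neq0.
Qed.

Lemma vanish_at_vprod P s : P.2 \in s -> vanish_at P (vprod s).
Proof.
move=> Ps; rewrite /vprod; have [c ->] := linprod_mem o2 o3 P.2 s Ps.
have [_ _] := vanish_at_ideal P; apply; apply: mem_igen.
by rewrite !inE eqxx orbT.
Qed.

Fixpoint stair (Bs : seq (F * F)) (r : seq ((F * F) * nat)) : T -> Prop :=
  if r is (a, n) :: r' then
    fun f => exists g h, stair Bs r' g /\ f = g * hform a + h * vprod (take n Bs)
  else fun=> True.

Definition stair_pts (Bs : seq (F * F)) (r : seq ((F * F) * nat)) :=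
  [seq (p.1, b) | p <- r, b <- take p.2 Bs].

Lemma stair_ideal Bs r : ideal (stair Bs r).
Proof.
elim: r => [|[a n] r [S0 SD SM]] //; split.
- by exists 0, 0; rewrite !mul0r addr0.
- move=> _ _ [g [h [Sg ->]]] [g' [h' [Sg' ->]]]; exists (g + g'), (h + h').
  by rewrite !mulrDl addrACA; split=> //; apply: SD.
- move=> c _ [g [h [Sg ->]]]; exists (c * g), (c * h).
  by rewrite mulrDr !mulrA; split=> //; apply: SM.
Qed.

Lemma stair_vprod Bs r m : all (fun p => p.2 <= m)%N r -> stair Bs r (vprod (take m Bs)).
Proof.
case: r => [|[a n] r] //= /andP[nm _].
have [c E] := linprod_take o2 o3 n m Bs nm; exists 0, c.
by rewrite mul0r add0r; split=> //; case: (stair_ideal Bs r).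
Qed.

Lemma stair_ptsP Bs r P :
  reflect (exists p, [/\ p \in r, P.2 \in take p.2 Bs & P.1 = p.1]) (P \in stair_pts Bs r).
Proof.
apply: (iffP allpairsPdep) => [[p [b [pr bB ->]]]|[p [pr bB E]]]; first by exists p.
by exists p, P.2; split=> //; rewrite -E; case: (P).
Qed.

Lemma stair_pts_nz Bs r P : all nz Bs -> all (fun p => nz p.1) r ->
  P \in stair_pts Bs r -> nz2 P.
Proof.
move=> /allP nzB /allP nzr /stair_ptsP[p [pr /mem_take PB E]].
by rewrite /nz2 E nzr // nzB.
Qed.

Lemma stair_vanish Bs r f :
  all nz Bs -> pairwise (fun a b => ~~ same a b) Bs ->
  all (fun p => nz p.1) r -> pairwise (fun p q => ~~ same p.1 q.1) r ->
  pairwise (fun p q => q.2 <= p.2)%N r ->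
  vanish (stair_pts Bs r) f <-> stair Bs r f.
Proof.
move=> nzB pB; elim: r f => [|[a n] r IH] f /=; first by split=> // _ P.
case/andP=> nza nzr /andP[/allP ar pr] /andP[/allP nr dr].
have {}IH g : vanish (stair_pts Bs r) g <-> stair Bs r g by exact: IH.
have nzX P : P \in stair_pts Bs r -> nz2 P by apply: stair_pts_nz.
have subX P : P \in stair_pts Bs r -> P.2 \in take n Bs.
  case/stair_ptsP=> p [/nr /= pn PB _].
  by rewrite -(take_takel Bs pn) in PB; apply: mem_take PB.
have [VD VM] : (forall P g h, vanish_at P g -> vanish_at P h -> vanish_at P (g + h)) /\
   (forall P g h, vanish_at P h -> vanish_at P (g * h)).
  by split=> P; case: (vanish_at_ideal P).
split=> [fX|[g [h [/IH gX ->]]] P].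
  have [g gE] := kill_congr o0 o1 a f isT nza.
  have [||b bB|h hE] := linprod_dvd o2 o3 isT (take n Bs) (killH a f).
  - by apply/allP=> b /mem_take; apply: (allP nzB).
  - by apply: subseq_pairwise pB; apply: take_subseq.
  - have nzb : nz b by apply: (allP nzB); apply: mem_take bB.
    apply/killP => //; rewrite -/(killV b _).
    apply/(vanish_atP (a, b)); first by rewrite /nz2 nza.
    by apply: fX; apply/stair_ptsP; exists (a, n); rewrite mem_head.
  have fE : f = g * hform a + h * vprod (take n Bs) by rewrite -gE -hE subrK.
  exists g, h; split=> //; apply/IH => P PX.
  have nP := nzX P PX.
  apply: (vanish_atM _ (hform a)) => //; last first.
    move/vanish_at_hform => /(_ nP); case/stair_ptsP: PX => p [/ar /=].
    by rewrite same_sym => /negPf Eap _ ->; rewrite Eap.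
  have -> : hform a * g = f + (- h) * vprod (take n Bs).
    by rewrite fE mulNr addrK mulrC.
  apply: VD; last by apply: VM; apply: vanish_at_vprod; apply: subX.
  apply: fX; rewrite /stair_pts /= mem_cat; apply/orP; right; exact: PX.
rewrite /stair_pts /= mem_cat => /orP[/mapP[b bB ->]|PX].
  by apply: VD; apply: VM; [apply: mem_igen; rewrite mem_head|apply: vanish_at_vprod].
by apply: VD; [rewrite mulrC|]; apply: VM; [apply: gX|apply/vanish_at_vprod/subX].
Qed.

End Staircase.

Section StaircaseRegularity.
Context {F : fieldType}.
Local Notation T := {mpoly F[4]}.
Implicit Types (a b c d : F * F) (f g u w : T).

Definition zeroH : T -> T := msubst (fun k => if (k < 2)%N then 0 else 'X_k).
HB.instance Definition _ := GRing.RMorphism.on zeroH.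
HB.instance Definition _ := GRing.Linear.on zeroH.

Lemma zeroH_hform a : zeroH (hform a) = 0.
Proof. by rewrite linearB !linearZ /= /zeroH !msubstX /= oppr0 !scaler0 addr0. Qed.

Lemma zeroH_vform b : zeroH (vform b) = vform b.
Proof. by rewrite linearB !linearZ /= /zeroH !msubstX /= scalerN. Qed.

Lemma zeroH_vprod s : zeroH (vprod s) = vprod s.
Proof. by rewrite rmorph_prod; apply: eq_bigr => b _; apply: zeroH_vform. Qed.

Lemma ord4P (Q : 'I_4 -> Prop) : Q o0 -> Q o1 -> Q o2 -> Q o3 -> forall k, Q k.
Proof.
move=> Q0 Q1 Q2 Q3 k; have : k \in [:: o0; o1; o2; o3] by case: k => [[|[|[|[|]]]]].
by rewrite !inE => /or4P[]/eqP->.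
Qed.

Lemma zeroH_congr a c f : ~~ same a c ->
  exists u w, f - zeroH f = u * hform a + w * hform c.
Proof.
rewrite /same -subr_eq0 => D0; set D := _ - _ in D0.
suff /igen_cons[u [h [/igen1[w ->] E]]] : igen [:: hform a; hform c] (f - zeroH f).
  by exists u, w.
have iJ := igen_ideal [:: hform a; hform c]; have [I0 ID IM] := iJ.
have DE : (D^-1)%:MP * D%:MP = 1 :> T by rewrite -rmorphM /= mulVf ?rmorph1.
have D1 : D%:MP = a.1%:MP * c.2%:MP - a.2%:MP * c.1%:MP :> T.
  by rewrite rmorphB !rmorphM.
have Ha : igen [:: hform a; hform c] (hform a) by apply: mem_igen; rewrite mem_head.
have Hc : igen [:: hform a; hform c] (hform c).
  by apply: mem_igen; rewrite !inE eqxx orbT.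
apply: msubst_congr => //; apply: ord4P; rewrite /= ?subrr // subr0.
- have -> : 'X_o0 = (D^-1)%:MP * (a.1%:MP * hform c + (- c.1%:MP) * hform a) :> T.
    rewrite -[LHS]mul1r -DE -mulrA; congr (_ * _).
    by rewrite D1 /hform /lin -!mul_mpolyC; ring.
  by apply: (IM); apply: ID; apply: IM.
- have -> : 'X_o1 = (D^-1)%:MP * (a.2%:MP * hform c + (- c.2%:MP) * hform a) :> T.
    rewrite -[LHS]mul1r -DE -mulrA; congr (_ * _).
    by rewrite D1 /hform /lin -!mul_mpolyC; ring.
  by apply: (IM); apply: ID; apply: IM.
Qed.

Lemma stair_regular Bs r c d f :
  all nz Bs -> nz c -> all (fun b => ~~ same b d) Bs ->
  all (fun p => ~~ same p.1 c) r -> pairwise (fun p q => q.2 <= p.2)%N r ->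
  add_igen (stair Bs r) [:: hform c] (f * vform d) ->
  add_igen (stair Bs r) [:: hform c] f.
Proof.
move=> nzB nzc Bd; elim: r f => [|[a n] r IH] f /=.
  by move=> _ _ _; apply: add_igen_l.
case/andP=> ac rc /andP[/allP nr dr]; case/add_igen1=> _ [e [[g [h [Sg ->]]] fE]].
set V := vprod _ in fE.
have nzT : all nz (take n Bs) by apply/allP=> b /mem_take; apply: (allP nzB).
have [u uE] : exists u, zeroH f = u * V.
  apply: (linprod_coprime o2 o3 isT (take n Bs) (vform d) (zeroH f) (zeroH h)) => //.
    move=> b bT; rewrite kill_lin_neq0 //; last by apply: (allP nzT).
    by apply: (allP Bd); apply: mem_take bT.
  have := congr1 zeroH fE; rewrite !rmorphD !rmorphM /= !zeroH_hform !mulr0.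
  by rewrite add0r addr0 zeroH_vform /V zeroH_vprod mulrC.
have [w [w' wE]] := zeroH_congr a c f ac.
have {wE}fE' : f = u * V + w * hform a + w' * hform c.
  by rewrite -uE -addrA -wE addrC subrK.
pose y := vform d.
have E1 : hform a * (w * y - g) = (h - u * y) * V + (e - w' * y) * hform c.
  move: fE; rewrite -/y fE' => fE.
  have := congr1 (fun z => z - (u * V + w' * hform c) * y - g * hform a) fE.
  move=> /= E; transitivity ((u * V + w * hform a + w' * hform c) * y -
     (u * V + w' * hform c) * y - g * hform a); first by ring.
  by rewrite E; ring.
have [k kE] : exists k, killH c (w * y - g) = k * V.
  apply: (linprod_coprime o2 o3 isT (take n Bs) (killH c (hform a)) _
     (killH c (h - u * y))) => //.
    move=> b _; rewrite -/(killV b _) {1}/killH /hform kill_lin // linearZ /=.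
    rewrite -/(hform _) killV_hform -kill_lin //.
    by rewrite kill_lin_neq0 // same_sym.
  have := congr1 (killH c) E1; rewrite [LHS]rmorphM [RHS]rmorphD /= => ->.
  by rewrite !rmorphM /= killH_vprod [killH c (hform c)]kill_self // mulr0 addr0.
have [m mE] := kill_congr o0 o1 c (w * y - g) isT nzc.
have wy : w * y = (g + k * V) + m * hform c.
  move: mE; rewrite -/(killH c _) kE => mE.
  by rewrite -[m * _]mE; ring.
have [g2 [e2 [Sg2 wE]]] : exists g2 e2, stair Bs r g2 /\ w = g2 + e2 * hform c.
  apply/add_igen1/IH => //; apply/add_igen1; exists (g + k * V), m; split=> //.
  have [S0 SD SM] := stair_ideal Bs r; apply: SD => //; apply: SM.
  by apply: stair_vprod; apply/allP.
apply/add_igen1; exists (g2 * hform a + u * V), (e2 * hform a + w').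
by split; [exists g2, u|rewrite fE' wE; ring].
Qed.

End StaircaseRegularity.

Section AlgebraicDependence.
Context {F : fieldType}.
Local Notation T := {mpoly F[4]}.

Lemma linear_dependence (I J : finType) (M : I -> J -> F) : (#|J| < #|I|)%N ->
  exists c : I -> F, (exists i, c i != 0) /\ forall j, \sum_i c i * M i j = 0.
Proof.
move=> JI; pose A := \matrix_(i < #|I|, j < #|J|) M (enum_val i) (enum_val j).
have : kermx A != 0.
  by rewrite kermx_eq0 /row_free neq_ltn (leq_ltn_trans (rank_leq_col A)).
case/matrix0Pn=> i [k nzik]; exists (fun x => kermx A i (enum_rank x)); split.
  by exists (enum_val k); rewrite enum_valK.
move=> j; have /matrixP/(_ i (enum_rank j)) := mulmx_ker A.
rewrite mxE [RHS]mxE => E; rewrite -[RHS]E (reindex (fun k : 'I_#|I| => enum_val k)) /=;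
  last exact/onW_bij/enum_val_bij.
by apply: eq_bigr => l _; rewrite enum_valK [A _ _]mxE enum_rankK.
Qed.

Section Restriction.
Context (P : (F * F) * (F * F)).

Definition restrict : T -> {mpoly F[2]} := msubst (fun k : 'I_4 =>
  nth 0 [:: P.1.1 *: 'X_ord0; P.1.2 *: 'X_ord0; P.2.1 *: 'X_ord_max; P.2.2 *: 'X_ord_max] k).
HB.instance Definition _ := GRing.RMorphism.on restrict.
HB.instance Definition _ := GRing.Linear.on restrict.

Lemma restrict_vanish f : nz2 P -> restrict f = 0 -> vanish_at P f.
Proof.
move=> nzP f0; apply/vanish_atP => //.
pose s (i : 'I_2) : T := if i == ord0 then hform (dual P.1) else vform (dual P.2).
suff -> : killV P.2 (killH P.1 f) = msubst s (restrict f) by rewrite f0 rmorph0.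
rewrite /killV /killH /kill /restrict !msubst_comp; apply: eq_msubst.
apply: ord4P; rewrite /= ?linearZ /= ?msubstX /= ?linearZ /= ?msubstX /s //=; congr (_ *: _);
  exact: killV_hform.
Qed.

End Restriction.

Lemma msizeM_bound n (p q : {mpoly F[n]}) k l :
  (msize p <= k.+1 -> msize q <= l.+1 -> msize (p * q) <= (k + l).+1)%N.
Proof.
have [->|p0] := eqVneq p 0; first by rewrite mul0r msize0.
have [->|q0] := eqVneq q 0; first by rewrite mulr0 msize0.
by rewrite msizeM //; move: (msize p) (msize q) => x y; lia.
Qed.

Lemma msizeX_bound n (p : {mpoly F[n]}) k e :
  (msize p <= k.+1 -> msize (p ^+ e) <= (e * k).+1)%N.
Proof.
move=> pk; elim: e => [|e IH]; first by rewrite expr0 msize1.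
by rewrite exprS mulSn; apply: msizeM_bound.
Qed.

Lemma card_monomials2 (d : nat) : (#|{: 'X_{1..2 < d}}| <= d * d)%N.
Proof.
have dm (m : 'X_{1..2 < d}) (i : 'I_2) : (m i < d)%N.
  apply: leq_ltn_trans (bmdeg m); rewrite mdegE (bigD1 i) //=; exact: leq_addr.
pose h (m : 'X_{1..2 < d}) := (Ordinal (dm m ord0), Ordinal (dm m ord_max)).
have -> : (d * d = #|{: 'I_d * 'I_d}|)%N by rewrite card_prod card_ord.
apply: (@leq_card _ _ h) => m m' [E0 E1].
apply/val_inj/mnmP => i; case: i => [[|[|//]] i2].
  by have -> : Ordinal i2 = ord0 by apply: val_inj.
by have -> : Ordinal i2 = ord_max by apply: val_inj.
Qed.

Lemma algebraic_dependence X (a0 a1 a2 : T) : all nz2 X ->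
  exists (N : nat) (c : nat -> nat -> nat -> F),
    (exists i j k, [/\ (i < N)%N, (j < N)%N, (k < N)%N & c i j k != 0]) /\
    vanish X (\sum_(i < N) (\sum_(j < N) (\sum_(k < N) (c i j k)%:MP * a2 ^+ k)
                              * a1 ^+ j) * a0 ^+ i).
Proof.
move=> nzX.
have [D DX] : exists D, forall P, P \in X -> (msize (restrict P a0) <= D.+1 /\
    msize (restrict P a1) <= D.+1 /\ msize (restrict P a2) <= D.+1)%N.
  elim: X {nzX} => [|P X [D IH]]; first by exists 0.
  exists (D + (msize (restrict P a0) + msize (restrict P a1) + msize (restrict P a2)))%N.
  move=> Q; rewrite inE => /orP[/eqP->|/IH]; lia.
pose N := (size X * (3 * D + 1) ^ 2).+1; pose d := (3 * (N * D)).+1.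
pose mono (t : 'I_N * 'I_N * 'I_N) : T := a2 ^+ t.2 * a1 ^+ t.1.2 * a0 ^+ t.1.1.
have szm P t : P \in X -> (msize (restrict P (mono t)) <= d)%N.
  move=> /DX[s0 [s1 s2]]; rewrite /mono !rmorphM !rmorphXn /=.
  case: t => [[i j] k] /=.
  apply: leq_trans (_ : (k * D + j * D + i * D).+1 <= _)%N.
    by apply: msizeM_bound; [apply: msizeM_bound|]; apply: msizeX_bound.
  have := (ltn_ord i, ltn_ord j, ltn_ord k); rewrite /d.
  case=> [[/ltnW iN /ltnW jN] /ltnW kN].
  have := leq_mul2r D k N; have := leq_mul2r D j N; have := leq_mul2r D i N.
  rewrite iN jN kN !orbT; lia.
pose M t (q : 'I_(size X) * 'X_{1..2 < d}) :=
  (restrict (nth ((0, 0), (0, 0)) X q.1) (mono t))@_q.2.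
have [|c [[[[i j] k] nzc] cM]] := linear_dependence _ _ M.
  rewrite !card_prod !card_ord.
  apply: leq_ltn_trans (leq_mul (leqnn _) (card_monomials2 d)) _.
  have dN : (d <= N * (3 * D + 1))%N by rewrite /d /N; nia.
  apply: leq_ltn_trans (leq_mul (leqnn _) (leq_mul dN dN)) _.
  have : (size X * (3 * D + 1) ^ 2 < N)%N by [].
  have : (0 < N)%N by [].
  move: N {d mono szm M dN} => N; nia.
exists N, (fun i j k => c (inord i, inord j, inord k)); split.
  by exists i, j, k; rewrite !ltn_ord !inord_val.
have -> : \sum_(i < N) (\sum_(j < N) (\sum_(k < N) (c (inord i, inord j, inord k))%:MP * a2 ^+ k)
                              * a1 ^+ j) * a0 ^+ i = \sum_t c t *: mono t.
  transitivity (\sum_ij \sum_k c (ij, k) *: mono (ij, k)); last first.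
    by rewrite pair_bigA; apply: eq_bigr => -[].
  transitivity (\sum_i \sum_j \sum_k c (i, j, k) *: mono (i, j, k)); last first.
    by rewrite pair_bigA; apply: eq_bigr => -[].
  apply: eq_bigr => i' _; rewrite mulr_suml; apply: eq_bigr => j' _.
  rewrite !mulr_suml; apply: eq_bigr => k' _.
  by rewrite !inord_val /mono -mul_mpolyC !mulrA.
move=> P PX; apply: restrict_vanish; first exact: (allP nzX).
rewrite linear_sum /=; apply/mpolyP => m; rewrite mcoeff0 linear_sum /=.
have [md|md] := ltnP (mdeg m) d; last first.
  rewrite big1 // => t _; rewrite linearZ /= mcoeffZ memN_msupp_eq0 ?mulr0 //.
  by apply: msize_mdeg_ge; apply: leq_trans md; apply: szm.
have PXi : (index P X < size X)%N by rewrite index_mem.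
rewrite -[RHS](cM (Ordinal PXi, BMultinom md)); apply: eq_bigr => t _.
by rewrite linearZ /= mcoeffZ /M /= nth_index.
Qed.

End AlgebraicDependence.

Lemma lowest_term {A : comNzRingType} (J J' : A -> Prop) (a : A) (N m : nat) (G : nat -> A) :
  ideal J' -> (forall f, J f -> J' f) -> (forall f, J (f * a) -> J f) -> J' a ->
  (m < N)%N -> (forall i, (i < m)%N -> G i = 0) ->
  J (\sum_(i < N) G i * a ^+ i) -> J' (G m).
Proof.
move=> [J0 JD JM] JJ' aJ J'a; elim: N m G => // N IH m G.
rewrite big_ord_recl expr0 mulr1 /=.
have -> : \sum_(i < N) G (bump 0 i) * a ^+ bump 0 i = (\sum_(i < N) G i.+1 * a ^+ i) * a.
  by rewrite mulr_suml; apply: eq_bigr => i _; rewrite /bump add1n exprSr mulrA.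
case: m => [|m] mN G0 JG; last first.
  apply: (IH m (fun i => G i.+1)) => // [i im|]; first exact: G0.
  by apply: aJ; rewrite G0 // add0r in JG.
set S := \sum_(i < N) _ in JG.
have -> : G 0%N = (G 0%N + S * a) + (- S) * a by rewrite mulNr addrK.
by apply: JD; [apply: JJ'|apply: JM].
Qed.

Section Dimension.
Context {F : closedFieldType}.
Local Notation T := {mpoly F[4]}.
Implicit Types (X : seq ((F * F) * (F * F))) (f : T) (a : F * F).

Lemma least_below (Q : pred nat) i N : (i < N)%N -> Q i ->
  exists m, [/\ (m < N)%N, Q m & forall l, (l < m)%N -> ~~ Q l].
Proof.
move=> iN Qi; have ex : exists i, Q i by exists i.
exists (ex_minn ex); case: ex_minnP => m Qm min; split=> // [|l].
  exact: leq_ltn_trans (min i Qi) iN.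
by apply: contraL => /min; rewrite -leqNgt.
Qed.

(* A relation between [a0], [a1], [a2] modulo [J 0], read from its
   lexicographically lowest term, puts a nonzero constant in [J 3]. *)
Lemma no_nonzerodivisor_triple X (J : nat -> T -> Prop) (a : nat -> T) : all nz2 X ->
  (forall f, vanish X f -> J 0 f) ->
  (forall i, (i < 3)%N -> [/\ ideal (J i.+1), (forall f, J i f -> J i.+1 f),
     (forall f, J i (f * a i) -> J i f) & J i.+1 (a i)]) ->
  J 3 1.
Proof.
move=> nzX XJ Ja.
have [I1 J01 n0 a1] := Ja 0 isT; have [I2 J12 n1 a2] := Ja 1 isT.
have [I3 J23 n2 a3] := Ja 2 isT.
have [N [c [[i [j [k [iN jN kN nzc]]]]]]] := algebraic_dependence X (a 0) (a 1) (a 2) nzX.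
move=> /XJ.
pose Q2 i j k := c i j k != 0.
pose Q1 i j := has (Q2 i j) (iota 0 N).
pose Q0 i := has (Q1 i) (iota 0 N).
have in_iota l : (l \in iota 0 N) = (l < N)%N by rewrite mem_iota.
have Q1P p q : reflect (exists2 r, (r < N)%N & Q2 p q r) (Q1 p q).
  by apply: (iffP hasP) => [[r]|[r]] => [|rN ?]; rewrite ?in_iota => *; exists r; rewrite ?in_iota.
have Q0P p : reflect (exists2 q, (q < N)%N & Q1 p q) (Q0 p).
  by apply: (iffP hasP) => [[r]|[r]] => [|rN ?]; rewrite ?in_iota => *; exists r; rewrite ?in_iota.
have [p [pN /Q0P[q' q'N Qq'] minp]] :
    exists m, [/\ (m < N)%N, Q0 m & forall l, (l < m)%N -> ~~ Q0 l].
  by apply: (least_below _ i) => //; apply/Q0P; exists j => //; apply/Q1P; exists k.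
have [q [qN /Q1P[r' r'N Qr'] minq]] := least_below (Q1 p) q' N q'N Qq'.
have [r [rN Qr minr]] := least_below (Q2 p q) r' N r'N Qr'.
pose G1 p q := \sum_(k < N) (c p q k)%:MP * a 2 ^+ k : T.
pose G0 p := \sum_(j < N) G1 p j * a 1 ^+ j.
have c0 x y z : ~~ Q2 x y z -> c x y z = 0 by rewrite negbK => /eqP.
have G10 x y : ~~ Q1 x y -> G1 x y = 0.
  move=> NQ; rewrite /G1 big1 // => l _; rewrite c0 ?rmorph0 ?mul0r //.
  by apply: contra NQ => Ql; apply/Q1P; exists l.
have G00 x : ~~ Q0 x -> G0 x = 0.
  move=> NQ; rewrite /G0 big1 // => l _; rewrite G10 ?mul0r //.
  by apply: contra NQ => Ql; apply/Q0P; exists l.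
move=> /(lowest_term (J 0) (J 1) (a 0) N p G0 I1 J01 n0 a1 pN
  (fun l lp => G00 l (minp l lp))).
move=> /(lowest_term (J 1) (J 2) (a 1) N q (G1 p) I2 J12 n1 a2 qN
  (fun l lq => G10 p l (minq l lq))).
move=> /(lowest_term (J 2) (J 3) (a 2) N r (fun k => (c p q k)%:MP) I3 J23 n2 a3 rN).
have [_ _ JM] := I3; move=> Jc.
have -> : 1 = ((c p q r)^-1)%:MP * (c p q r)%:MP :> T by rewrite -rmorphM /= mulVf ?rmorph1.
apply: JM; apply: Jc => l lr; rewrite c0 ?rmorph0 //; exact: minr.
Qed.

Lemma vanish_chain_le X n (P : nat -> T -> Prop) : all nz2 X -> chain (vanish X) n P -> (n <= 2)%N.
Proof.
move=> nzX [Pprime Pinc]; rewrite leqNgt; apply/negP => n3.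
have [P01 [a0 [Pa0 na0]]] := Pinc 0 (leq_trans (isT : 0 < 3)%N n3).
have [P12 [a1 [Pa1 na1]]] := Pinc 1 (leq_trans (isT : 1 < 3)%N n3).
have [P23 [a2 [Pa2 na2]]] := Pinc 2 n3.
have [[_ N1 _] _] := Pprime 3 n3.
apply: N1; apply: (no_nonzerodivisor_triple X P (nth 0 [:: a0; a1; a2])) => //.
  by case: (Pprime 0 (leq0n n)).
move=> i i3; have [[Ii _ _] _] := Pprime i.+1 (leq_trans i3 n3).
have [[_ _ PM] _] := Pprime i (leq_trans (ltnW i3) n3).
split=> //; first by case: i i3 {Ii PM} => [|[|[|]]].
  move=> f /PM[] //; by case: i i3 {Ii PM} => [|[|[|]]].
by case: i i3 {Ii PM} => [|[|[|]]].
Qed.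

Lemma vanish_regular_le X (m : T -> Prop) s :
  all nz2 X -> regular m (vanish X) s -> (size s <= 2)%N.
Proof.
move=> nzX [sreg N1]; rewrite leqNgt; apply/negP => s3; apply: N1.
have iV := vanish_ideal X.
have add_mono (s1 s2 : seq T) f : {subset s1 <= s2} ->
    add_igen (vanish X) s1 f -> add_igen (vanish X) s2 f.
  move=> s12; apply: add_igen_sub; first exact: add_igen_ideal.
    by move=> g; apply: add_igen_l.
  by move=> g /s12 gs; apply: add_igen_r => //; apply: mem_igen.
apply: (add_mono (take 3 s)) => [f|]; first exact: mem_take.
apply: (no_nonzerodivisor_triple X (fun i => add_igen (vanish X) (take i s)) (nth 0 s)) => //.
  by move=> f; apply: add_igen_l.
move=> i i3; have is_ : (i < size s)%N by apply: leq_trans s3.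
split; first exact: add_igen_ideal.
- move=> f; apply: add_mono => g; rewrite (take_nth 0) // mem_rcons inE => ->; exact: orbT.
- by move=> f; case: (sreg i is_) => _; apply.
- apply: add_igen_r => //; apply: mem_igen.
  by rewrite (take_nth 0) // mem_rcons mem_head.
Qed.

Definition zeroHV : T -> T := msubst (fun=> 0).
HB.instance Definition _ := GRing.RMorphism.on zeroHV.
HB.instance Definition _ := GRing.Linear.on zeroHV.

Lemma zeroHV_lin i j a : zeroHV (lin i j a) = 0.
Proof. by rewrite linearB !linearZ /= /zeroHV !msubstX /= oppr0 !scaler0 addr0. Qed.

Lemma zeroHV_msubst (s : 'I_4 -> T) f :
  (forall i, zeroHV (s i) = 0) -> zeroHV (msubst s f) = zeroHV f.
Proof. by move=> s0; rewrite /zeroHV msubst_comp; apply: eq_msubst. Qed.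

Lemma zeroHV_vanish (P : (F * F) * (F * F)) f : vanish_at P f -> zeroHV f = 0.
Proof.
apply: (igen_sub _ (fun g => zeroHV g = 0)); first by case: (kernel_prime zeroHV).
by move=> g; rewrite !inE => /orP[]/eqP->; apply: zeroHV_lin.
Qed.

Lemma vanish_chain X : X != [::] -> all nz2 X -> exists P : nat -> T -> Prop, chain (vanish X) 2 P.
Proof.
case: X => [|Q X] // _ nzX; have nzQ : nz2 Q by case/andP: nzX.
have [nzH nzV] := andP nzQ.
pose p0 f := killV Q.2 (killH Q.1 f) = 0; pose p1 f := killV Q.2 (zeroH f) = 0.
pose p2 f := zeroHV f = 0.
have p0P f : p0 f -> vanish_at Q f by move=> pf; apply/vanish_atP.
have p01 f : p0 f -> p1 f.
  move/p0P; apply: igen_sub.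
    by case: (kernel_prime (killV Q.2 \o zeroH)).
  move=> g; rewrite !inE /p1 => /orP[]/eqP->; first by rewrite zeroH_hform rmorph0.
  by rewrite zeroH_vform /killV kill_self.
have p12 f : p1 f -> p2 f.
  rewrite /p1 /p2 => /(congr1 zeroHV); rewrite rmorph0 /killV /zeroH => E.
  have X0 k : zeroHV ('X_k) = 0 by rewrite /zeroHV msubstX.
  rewrite -E zeroHV_msubst => [|k]; last first.
    by do 2?[case: ifP => _]; rewrite ?X0 // linearZ /= zeroHV_lin scaler0.
  by rewrite zeroHV_msubst // => k; case: ifP; rewrite ?rmorph0 ?X0.
have inc f : vanish (Q :: X) f -> p0 f by move=> /(_ Q (mem_head _ _))/vanish_atP; apply.
exists (fun i => match i with 0%N => p0 | 1%N => p1 | _ => p2 end); split.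
  case=> [_|[_|[_|i i2]]].
  - by split; [exact: (kernel_prime (killV Q.2 \o killH Q.1))|exact: inc].
  - by split; [exact: (kernel_prime (killV Q.2 \o zeroH))|move=> f /inc; apply: p01].
  - by split; [exact: (kernel_prime zeroHV)|move=> f /inc /p01; apply: p12].
  - by move: i2; rewrite !ltnS ltn0.
have dn a : nz a -> ~~ same a (dual a).
  move=> nza; rewrite /same -subr_eq0 mulrC [a.2 * _]mulrC dualP //.
  exact: oner_neq0.
case=> [_|[_|i i2]]; last by move: i2; rewrite !ltnS ltn0.
- split; first exact: p01.
  exists (hform (dual Q.1)); split; first by rewrite /p1 zeroH_hform rmorph0.
  by move/p0P/vanish_at_hform => /(_ nzQ); apply/negP/dn.
- split; first exact: p12.
  exists (vform (dual Q.2)); split; first exact: zeroHV_lin.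
  by rewrite /p1 zeroH_vform; apply/eqP; rewrite /killV kill_lin_neq0 // dn.
Qed.

Lemma exists_not_same (s : seq (F * F)) : all nz s ->
  exists c : F * F, nz c /\ all (fun a => ~~ same a c) s.
Proof.
move=> /allP nzs.
have [t tE] : exists t : F, t \notin [seq a.2 / a.1 | a <- s].
  pose q := \prod_(x <- [seq a.2 / a.1 | a <- s]) ('X - x%:P) + 1 : {poly F}.
  have [s0|s0] := eqVneq (size s) 0; first by exists 0; case: (s) s0.
  have [|t rt] := closed_rootP q _.
    rewrite size_polyDl size_prod_XsubC size_map ?eqSS // size_poly1.
    by rewrite ltnS lt0n.
  exists t; apply/negP => ts; move: rt.
  have : root (\prod_(x <- [seq a.2 / a.1 | a <- s]) ('X - x%:P)) t.
    by rewrite root_prod_XsubC.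
  by rewrite /root /q hornerD hornerC => /eqP->; rewrite add0r oner_eq0.
exists (1, t); rewrite /nz oner_neq0; split=> //; apply/allP => a as_.
apply: contra tE; rewrite /same mulr1 /= => /eqP E; apply/mapP; exists a => //.
have [a0|a0] := eqVneq a.1 0; last by rewrite -E mulrC mulKf.
by have := nzs a as_; rewrite /nz -E a0 mul0r eqxx.
Qed.

Lemma stair_depth (Bs : seq (F * F)) r : let X := stair_pts Bs r in X != [::] ->
  all nz Bs -> pairwise (fun a b => ~~ same a b) Bs ->
  all (fun p => nz p.1) r -> pairwise (fun p q => ~~ same p.1 q.1) r ->
  pairwise (fun p q => q.2 <= p.2)%N r ->
  exists s, size s = 2 /\ regular (igen [:: 'X_o0; 'X_o1; 'X_o2; 'X_o3]) (vanish X) s.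
Proof.
move=> X X0 nzB pB nzr pr dr.
have XS f : vanish X f <-> stair Bs r f by apply: stair_vanish.
have [c [nzc cr]] : exists c, nz c /\ all (fun a => ~~ same a c) (map fst r).
  by apply: exists_not_same; rewrite all_map.
have [d [nzd dB]] := exists_not_same Bs nzB.
rewrite all_map in cr.
have max_lin i j a : i \in [:: o0; o1; o2; o3] -> j \in [:: o0; o1; o2; o3] ->
    igen [:: 'X_o0; 'X_o1; 'X_o2; 'X_o3] (lin i j a : T).
  have [I0 ID IM] := igen_ideal ([:: 'X_o0; 'X_o1; 'X_o2; 'X_o3] : seq T).
  move=> i4 j4; rewrite /lin -!mul_mpolyC -mulNr.
  have Xm k : k \in [:: o0; o1; o2; o3] -> ('X_k : T) \in [:: 'X_o0; 'X_o1; 'X_o2; 'X_o3].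
    by move=> k4; apply: (map_f (fun k => 'X_k) k4).
  by apply: ID; apply: IM; apply: mem_igen; apply: Xm.
exists [:: hform c; vform d]; split=> //; split; last first.
  have [Q QX] : exists Q, Q \in X by case: (X) X0 => // Q X' _; exists Q; rewrite mem_head.
  have [K0 K1 _] := kernel_prime zeroHV.
  move=> E; apply: K1; apply: (add_igen_sub _ _ (fun g => zeroHV g = 0) 1 _ _ _ E) => //
    [g /(_ Q QX)|g]; first exact: zeroHV_vanish.
  by rewrite !inE => /orP[]/eqP->; apply: zeroHV_lin.
case=> [|[|]] //= _; split; try by apply: max_lin.
- move=> f [g [h [gX /igen_nil -> E]]]; apply: add_igen_l => Q QX.
  have nzQ : nz2 Q by apply: stair_pts_nz QX.
  apply: (vanish_atM _ (hform c)) => //; first by rewrite mulrC E addr0; apply: gX.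
  move/vanish_at_hform => /(_ nzQ); case/stair_ptsP: QX => p [pr' _ ->].
  by apply/negP; apply: (allP cr).
- have VS f : add_igen (vanish X) [:: hform c] f <-> add_igen (stair Bs r) [:: hform c] f.
    by split=> -[g [h [/XS Sg Sh ->]]]; exists g, h.
  by move=> f /VS/stair_regular E; apply/VS/E.
Qed.

End Dimension.

Section LinesAndPoints.
Context {F : fieldType}.
Local Notation T := {mpoly F[4]}.
Implicit Types (a b : F * F) (P : (F * F) * (F * F)) (X : seq ((F * F) * (F * F))).
Implicit Types (As Bs Hs Vs : seq (F * F)) (f g L : T).

Definition separated (s : seq (F * F)) := pairwise (fun a b => ~~ same a b) s.

Lemma same_trans a b c : nz b -> same a b -> same c b -> same a c.
Proof.
rewrite /nz /same => nzb /eqP ab /eqP cb; apply/eqP.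
have [b1|b1] := eqVneq b.1 0; last first.
  by apply: (mulfI b1); rewrite mulrCA -[b.1 * c.2]mulrC -cb mulrCA mulrC ab; ring.
rewrite b1 eqxx /= in nzb; apply: (mulfI nzb).
by rewrite mulrA [b.2 * _]mulrC ab -mulrA [b.1 * _]mulrC -cb; ring.
Qed.

Lemma vanish_at_lines P Hs Vs f : nz2 P ->
  (forall a, a \in Hs -> ~~ same P.1 a) -> (forall b, b \in Vs -> ~~ same P.2 b) ->
  vanish_at P (f * (hprod Hs * vprod Vs)) -> vanish_at P f.
Proof.
move=> nzP PH PV; rewrite mulrC -mulrA.
elim: Hs PH => [|a s IH] PH.
  rewrite /hprod /linprod big_nil mul1r; elim: Vs PV => [|b s IH] PV.
    by rewrite /vprod /linprod big_nil mul1r.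
  rewrite /vprod linprod_cons -mulrA => /vanish_atM E; apply: IH => [c cs|].
    by apply: PV; rewrite inE cs orbT.
  by apply: E => // /vanish_at_vform => /(_ nzP); apply/negP/PV/mem_head.
rewrite /hprod linprod_cons -mulrA => /vanish_atM E; apply: IH => [c cs|].
  by apply: PH; rewrite inE cs orbT.
by apply: E => // /vanish_at_hform => /(_ nzP); apply/negP/PH/mem_head.
Qed.

Lemma lines_vanish X Hs Vs f : all nz2 X ->
  all nz Hs -> all nz Vs -> separated Hs -> separated Vs ->
  (forall P, P \in X -> (forall a, a \in Hs -> ~~ same P.1 a) /\
                        (forall b, b \in Vs -> ~~ same P.2 b)) ->
  (vanish X f /\ (forall a, a \in Hs -> igen [:: hform a] f) /\
                 (forall b, b \in Vs -> igen [:: vform b] f)) <->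
  exists g, f = g * (hprod Hs * vprod Vs) /\ vanish X g.
Proof.
move=> /allP nzX nzH nzV sH sV XHV; split=> [[fX [fH fV]]|[g [-> gX]]].
  have [h hE] := linprod_dvd o0 o1 isT Hs f nzH sH fH.
  have [b bV|g gE] := linprod_dvd o2 o3 isT Vs h nzV sV.
    have nzb := allP nzV b bV; apply/killP => //; apply/eqP.
    have /eqP := proj1 (killP o2 o3 b f isT nzb) (fV b bV).
    rewrite hE rmorphM /= mulf_eq0 => /orP[//|].
    suff -> : kill o2 o3 b (linprod o0 o1 Hs) = linprod o0 o1 Hs.
      by rewrite (negPf (linprod_neq0 _ _ _ _ _)).
    by rewrite rmorph_prod; apply: eq_bigr => a _; apply: (killV_hform a b).
  have fE : f = g * (hprod Hs * vprod Vs) by rewrite hE gE mulrAC mulrA.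
  exists g; split=> // P PX; have [PH PV] := XHV P PX.
  by apply: (vanish_at_lines P Hs Vs) => //; [apply: nzX|rewrite -fE; apply: fX].
split; last split.
- move=> P PX; have [_ _ IM] := vanish_at_ideal P.
  by rewrite mulrC; apply: IM; apply: gX.
- move=> a aH; apply/igen1; have [c E] := linprod_mem o0 o1 a Hs aH.
  by exists (g * vprod Vs * c); rewrite /hprod E /hform; ring.
- move=> b bV; apply/igen1; have [c E] := linprod_mem o2 o3 b Vs bV.
  by exists (g * hprod Hs * c); rewrite /vprod E /vform; ring.
Qed.

Definition minl (s : seq nat) : nat := foldr minn (head 0 s) s.

Lemma minl_le s x : x \in s -> (minl s <= x)%N.
Proof.
rewrite /minl; elim: s (head 0 s) => // y s IH z; rewrite inE /= geq_min.
by case/orP=> [/eqP->|/IH->]; rewrite ?leqnn ?orbT.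
Qed.

Lemma minl_mem s : s != [::] -> minl s \in s.
Proof.
case: s => // x s _; rewrite /minl /=.
have : foldr minn x s \in x :: s.
  elim: s => [|y s IH] /=; first exact: mem_head.
  rewrite /minn; case: ifP => _; rewrite !inE ?eqxx ?orbT //.
  by move: IH; rewrite inE => /orP[]->; rewrite ?orbT.
by rewrite /minn; case: ifP => // _; rewrite mem_head.
Qed.

Section Generators.
Context (As Bs : seq (F * F)) (L : T) (D : seq (nat * nat)).
Context (D0 : D != [::]) (DA : forall p, p \in D -> (p.1 <= size As)%N).

Definition gen (i j : nat) : T := L * (hprod (take i As) * vprod (take j Bs)).
Let S := [seq gen p.1 p.2 | p <- D].
Let lo := minl [seq p.1 | p <- D].
Let bot := minl [seq p.2 | p <- D].
(* The width of row [i] of the staircase spanned by [D]; junk for [i < lo]. *)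
Let mu i := minl [seq p.2 | p <- D & (p.1 <= i)%N].
Let Bs' := drop bot Bs.

Definition rows (k : nat) : seq ((F * F) * nat) :=
  [seq (nth (0, 0) As i, (mu i - bot)%N) | i <- iota k (size As - k)].

Let lo_le p : p \in D -> (lo <= p.1)%N.
Proof. by move=> pD; apply/minl_le/map_f. Qed.

Let bot_le p : p \in D -> (bot <= p.2)%N.
Proof. by move=> pD; apply/minl_le/map_f. Qed.

Let mu_le p i : p \in D -> (p.1 <= i)%N -> (mu i <= p.2)%N.
Proof. by move=> pD pi; apply/minl_le/map_f; rewrite mem_filter pi. Qed.

Let lo_mem : exists2 p, p \in D & p.1 = lo.
Proof.
have : lo \in [seq p.1 | p <- D] by apply: minl_mem; case: (D) D0.
by case/mapP=> p pD ->; exists p.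
Qed.

Let bot_mem : exists2 p, p \in D & p.2 = bot.
Proof.
have : bot \in [seq p.2 | p <- D] by apply: minl_mem; case: (D) D0.
by case/mapP=> p pD ->; exists p.
Qed.

Let mu_mem i : (lo <= i)%N -> exists2 p, p \in D & (p.1 <= i)%N /\ p.2 = mu i.
Proof.
move=> loi; have : mu i \in [seq p.2 | p <- D & (p.1 <= i)%N].
  apply: minl_mem; have [p pD pE] := lo_mem.
  have : p.2 \in [seq p.2 | p <- D & (p.1 <= i)%N] by apply: map_f; rewrite mem_filter pE loi.
  by case: [seq p.2 | p <- D & _].
by case/mapP=> p; rewrite mem_filter => /andP[pi pD] ->; exists p.
Qed.

Let mu_mono i j : (lo <= i)%N -> (i <= j)%N -> (mu j <= mu i)%N.
Proof.
by move=> loi ij; have [p pD [pi <-]] := mu_mem i loi; apply: mu_le => //; apply: leq_trans ij.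
Qed.

Let lo_size : (lo <= size As)%N.
Proof. by have [p /DA pA <-] := lo_mem. Qed.

Lemma rows_cons k : (k < size As)%N ->
  rows k = (nth (0, 0) As k, (mu k - bot)%N) :: rows k.+1.
Proof. by move=> kA; rewrite /rows -[(size As - k)%N]prednK ?subn_gt0 //= subnS. Qed.

Lemma rows_fst : map fst (rows lo) = drop lo As.
Proof.
rewrite /rows -map_comp (eq_map (_ : _ =1 nth (0, 0) As)) // map_nth_iota ?subnKC //.
by rewrite take_oversize // size_drop.
Qed.

Lemma rows_decr : pairwise (fun p q => q.2 <= p.2)%N (rows lo).
Proof.
rewrite /rows pairwise_map.
apply: (@sub_in_pairwise _ (fun i => lo <= i)%N ltn); first last.
- by rewrite -sorted_pairwise; [apply: iota_ltn_sorted|apply: ltn_trans].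
- by apply/allP=> i; rewrite mem_iota => /andP[].
by move=> i j loi _ ij; apply: leq_sub2r; apply: mu_mono => //; apply: ltnW.
Qed.

Let vprod_split m : (bot <= m)%N ->
  vprod (take m Bs) = vprod (take (m - bot) Bs') * vprod (take bot Bs).
Proof.
move=> bm; rewrite mulrC /vprod -linprod_cat take_drop subnK //.
by rewrite -{1}(cat_take_drop bot (take m Bs)) take_takel.
Qed.

Let hprod_take k : (k < size As)%N ->
  hprod (take k.+1 As) = hform (nth (0, 0) As k) * hprod (take k As).
Proof.
by move=> kA; rewrite (take_nth (0, 0)) // /hprod -cats1 linprod_cat mulrC /linprod big_seq1.
Qed.

Let gen_mem p k : p \in D -> (p.1 <= k)%N -> igen S (gen k p.2).
Proof.
move=> pD pk; have [c E] := linprod_take o0 o1 _ _ As pk.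
have -> : gen k p.2 = c * gen p.1 p.2 by rewrite /gen /hprod E; ring.
by have [_ _] := igen_ideal S; apply; apply: mem_igen; apply: map_f.
Qed.

Lemma stair_gen k g : (lo <= k)%N -> (k <= size As)%N ->
  stair Bs' (rows k) g -> igen S (g * gen k bot).
Proof.
have [S0 SD SM] := igen_ideal S.
move En : (size As - k)%N => n; elim: n k g En => [|n IH] k g En lok kA.
  have -> : k = size As by apply/eqP; rewrite eqn_leq kA -subn_eq0 En.
  move=> _; apply: SM; have [p pD <-] := bot_mem; apply: gen_mem => //; exact: DA.
have {}kA : (k < size As)%N by rewrite -subn_gt0 En.
rewrite rows_cons // => -[g1 [h1 [Sg1 ->]]]; rewrite mulrDl; apply: SD.
  have -> : g1 * hform (nth (0, 0) As k) * gen k bot = g1 * gen k.+1 bot.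
    by rewrite /gen hprod_take //; ring.
  by apply: IH => //; [rewrite subnS En|apply: leqW].
have [p pD [pk pE]] := mu_mem k lok.
have -> : h1 * vprod (take (mu k - bot) Bs') * gen k bot = h1 * gen k p.2.
  by rewrite /gen pE (vprod_split (mu k)); [ring|rewrite -pE; apply: bot_le].
by apply: SM; apply: gen_mem.
Qed.

Lemma gen_stair p k : p \in D -> (k <= p.1)%N ->
  exists2 g, stair Bs' (rows k) g & gen p.1 p.2 = g * gen k bot.
Proof.
move=> pD; move En : (p.1 - k)%N => n; elim: n k En => [|n IH] k En kp.
  have -> : k = p.1 by apply/eqP; rewrite eqn_leq kp -subn_eq0 En.
  exists (vprod (take (p.2 - bot) Bs')).
    apply: stair_vprod; apply/allP=> _ /mapP[i + ->] /=.
    by rewrite mem_iota => /andP[pi _]; apply: leq_sub2r; apply: mu_le.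
  by rewrite /gen (vprod_split p.2) ?bot_le //; ring.
have {}kp : (k < p.1)%N by rewrite -subn_gt0 En.
have kA : (k < size As)%N by apply: leq_trans (DA p pD).
have [g Sg gE] : exists2 g, stair Bs' (rows k.+1) g & gen p.1 p.2 = g * gen k.+1 bot.
  by apply: IH => //; rewrite subnS En.
exists (g * hform (nth (0, 0) As k)).
  by rewrite rows_cons //; exists g, 0; rewrite mul0r addr0.
by rewrite gE /gen hprod_take //; ring.
Qed.

Lemma igen_stair f : igen S f <-> exists g, f = g * gen lo bot /\ stair Bs' (rows lo) g.
Proof.
have [S0 SD SM] := stair_ideal Bs' (rows lo).
split=> [|[g [-> Sg]]]; last exact: stair_gen lo g (leqnn _) lo_size Sg.
apply: (igen_sub _ (fun f => exists g, f = g * gen lo bot /\ stair Bs' (rows lo) g)).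
  split=> [|_ _ [g [-> Sg]] [h [-> Sh]]|r _ [g [-> Sg]]].
  - by exists 0; rewrite mul0r.
  - by exists (g + h); rewrite mulrDl; split=> //; apply: SD.
  - by exists (r * g); rewrite mulrA; split=> //; apply: SM.
move=> _ /mapP[p pD ->]; have [g Sg ->] := gen_stair p lo pD (lo_le p pD).
by exists g.
Qed.

End Generators.
End LinesAndPoints.

Section StandardGenerators.
Context {F : closedFieldType}.
Local Notation T := {mpoly F[4]}.
Implicit Types (X : seq ((F * F) * (F * F))) (Hs Vs As Bs : seq (F * F)) (S : seq T).

Definition cohen_macaulay (I : T -> Prop) : Prop := exists d : nat,
  ((exists P, chain I d P) /\ (forall n P, chain I n P -> (n <= d)%N)) /\
  ((exists s, size s = d /\ regular (igen [:: 'X_o0; 'X_o1; 'X_o2; 'X_o3]) I s) /\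
   (forall s, regular (igen [:: 'X_o0; 'X_o1; 'X_o2; 'X_o3]) I s -> (size s <= d)%N)).

Definition lines_points X Hs Vs : Prop :=
  all nz2 X /\ all nz Hs /\ all nz Vs /\
  pairwise (fun P Q => ~~ (same P.1 Q.1 && same P.2 Q.2)) X /\
  separated Hs /\ separated Vs /\
  (forall P, P \in X -> (forall a, a \in Hs -> ~~ same P.1 a) /\
                        (forall b, b \in Vs -> ~~ same P.2 b)).

Lemma stair_cohen_macaulay (Bs : seq (F * F)) r :
  let X := stair_pts Bs r in X != [::] ->
  all nz Bs -> separated Bs -> all (fun p => nz p.1) r ->
  pairwise (fun p q => ~~ same p.1 q.1) r -> pairwise (fun p q => q.2 <= p.2)%N r ->
  cohen_macaulay (vanish X).
Proof.
move=> X X0 nzB sB nzr sr dr.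
have nzX : all nz2 X by apply/allP=> P; apply: stair_pts_nz.
exists 2; split; split.
- exact: vanish_chain.
- by move=> n P; apply: vanish_chain_le.
- exact: stair_depth.
- by move=> s; apply: vanish_regular_le.
Qed.

Lemma stair_pts_distinct Bs r : separated Bs -> pairwise (fun p q => ~~ same p.1 q.1) r ->
  pairwise (fun P Q => ~~ (same P.1 Q.1 && same P.2 Q.2)) (stair_pts Bs r).
Proof.
move=> sB; elim: r => // -[a n] r IH /= /andP[/allP ar /IH pr].
rewrite /stair_pts /= pairwise_cat -/(stair_pts Bs r) pr andbT; apply/andP; split.
  apply/allrelP=> _ Q /mapP[b _ ->] /stair_ptsP[p [/ar /= nap _ ->]].
  by rewrite (negPf nap).
rewrite pairwise_map.
have := subseq_pairwise (take_subseq Bs n) sB; apply: sub_pairwise => b c /= /negPf->.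
by rewrite andbF.
Qed.

Lemma separated_cat X Hs As (pr : (F * F) * (F * F) -> F * F) :
  separated Hs -> separated As -> all nz As ->
  (forall P a, P \in X -> a \in Hs -> ~~ same (pr P) a) ->
  (forall a, a \in As -> has (fun P => same (pr P) a) X) -> separated (Hs ++ As).
Proof.
move=> sH sA nzA XH XA; rewrite /separated pairwise_cat; apply/and3P; split=> //.
apply/allrelP=> h a hH aA; have /hasP[P PX Pa] := XA a aA.
apply: contra (XH P h PX hH) => ha; exact: same_trans (allP nzA a aA) Pa ha.
Qed.

Lemma monomials_of S (G : nat -> nat -> T) m :
  (forall s, s \in S -> exists i j, (i <= m)%N /\ s = G i j) ->
  exists D : seq (nat * nat), (forall p, p \in D -> (p.1 <= m)%N) /\
    S = [seq G p.1 p.2 | p <- D].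
Proof.
elim: S => [|s S IH] SG; first by exists [::].
have [|D [Dm ->]] := IH; first by move=> t tS; apply: SG; rewrite inE tS orbT.
have [i [j [im ->]]] := SG s (mem_head _ _).
by exists ((i, j) :: D); split=> // p; rewrite inE => /orP[/eqP->|/Dm].
Qed.

Lemma subset_generators X Hs Vs As Bs S :
  lines_points X Hs Vs ->
  all nz As -> all nz Bs -> separated As -> separated Bs ->
  (forall a, a \in As -> has (fun P => same P.1 a) X) ->
  (forall b, b \in Bs -> has (fun P => same P.2 b) X) ->
  S <> [::] ->
  (forall s, s \in S -> exists i j, (i <= size As)%N /\
     s = gen As Bs (hprod Hs * vprod Vs) i j) ->
  exists X' Hs' Vs', [/\ lines_points X' Hs' Vs',
     X' = [::] \/ cohen_macaulay (vanish X') &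
     forall f, igen S f <-> (vanish X' f /\ (forall a, a \in Hs' -> igen [:: hform a] f) /\
                 (forall b, b \in Vs' -> igen [:: vform b] f))].
Proof.
move=> [nzX [nzH [nzV [_ [sH [sV XHV]]]]]] nzA nzB sA sB XA XB S0.
case/monomials_of=> D [DA SE]; have D0 : D != [::] by apply/eqP => D0; apply: S0; rewrite SE D0.
set lo := minl [seq p.1 | p <- D]; set bot := minl [seq p.2 | p <- D].
pose r := rows As D lo; pose Bs' := drop bot Bs; pose X' := stair_pts Bs' r.
have r1 : map fst r = drop lo As by apply: rows_fst.
have sHA : separated ((Hs ++ take lo As) ++ drop lo As).
  rewrite -catA cat_take_drop; apply: (separated_cat X Hs As fst) => //.
  by move=> P a PX; case: (XHV P PX) => + _; apply.
have sVB : separated ((Vs ++ take bot Bs) ++ drop bot Bs).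
  rewrite -catA cat_take_drop; apply: (separated_cat X Vs Bs snd) => //.
  by move=> P a PX; case: (XHV P PX) => _; apply.
move: sHA sVB; rewrite /separated !(pairwise_cat _ (_ ++ _)).
case/and3P=> /allrelP HA sH' sA' /and3P[/allrelP VB sV' sB'].
have nzB' : all nz Bs' by apply/allP=> b /mem_drop; apply: (allP nzB).
have nzr : all (fun p => nz p.1) r.
  by rewrite -(all_map fst nz) r1; apply/allP=> a /mem_drop; apply: (allP nzA).
have sr : pairwise (fun p q => ~~ same p.1 q.1) r.
  by rewrite -(pairwise_map fst (fun a b => ~~ same a b)) r1.
have dr : pairwise (fun p q => q.2 <= p.2)%N r by apply: rows_decr.
have lpX : lines_points X' (Hs ++ take lo As) (Vs ++ take bot Bs).
  split; first by apply/allP=> P; apply: stair_pts_nz.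
  split.
    by rewrite all_cat nzH; apply/allP=> a /mem_take; apply: (allP nzA).
  split; first by rewrite all_cat nzV; apply/allP=> b /mem_take; apply: (allP nzB).
  split; first exact: stair_pts_distinct.
  split=> //; split=> // P /stair_ptsP[p [pr /mem_take PB PE]].
  split=> [a aH|b bV]; rewrite same_sym; last exact: VB.
  by apply: HA => //; rewrite PE -r1; apply: map_f.
exists X', (Hs ++ take lo As), (Vs ++ take bot Bs); split=> //.
  have [->|X0] := eqVneq X' [::]; first by left.
  by right; apply: stair_cohen_macaulay.
move=> f; have [nzX' [nzH' [nzV' [_ [_ [_ XHV']]]]]] := lpX.
rewrite lines_vanish // SE igen_stair //.
have -> : hprod (Hs ++ take lo As) * vprod (Vs ++ take bot Bs) =
   gen As Bs (hprod Hs * vprod Vs) lo bot.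
  by rewrite /gen /hprod /vprod !linprod_cat; ring.
by split=> -[g [fE gX]]; exists g; split=> //; apply/(stair_vanish Bs' r g).
Qed.

Lemma standard_generator_shape As Bs (al : nat -> nat) (L s : T) :
  s \in [seq L * g | g <- [:: hprod (take (size As) As); vprod (take (size Bs) Bs)] ++
      [seq hprod (take i As) * vprod (take (al i) Bs) |
         i <- iota 1 (size As).-1 & (al i < al i.-1)%N]] ->
  exists i j, (i <= size As)%N /\ s = gen As Bs L i j.
Proof.
have v0 : vprod (take 0 Bs) = 1 by rewrite take0 /vprod /linprod big_nil.
have h0 : hprod (take 0 As) = 1 by rewrite take0 /hprod /linprod big_nil.
case/mapP=> g; rewrite mem_cat !inE -orbA => /or3P[/eqP->|/eqP->|/mapP[i + ->]] ->.
- by exists (size As), 0; rewrite /gen v0 mulr1.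
- by exists 0, (size Bs); rewrite /gen h0 mul1r.
- rewrite mem_filter mem_iota => /andP[_ iA].
  by exists i, (al i); split=> //; lia.
Qed.

Lemma gen00 As Bs (L : T) : gen As Bs L 0 0 = L.
Proof. by rewrite /gen !take0 /hprod /vprod /linprod !big_nil !mulr1. Qed.

End StandardGenerators.

Theorem theorem4p5 (X : seq pt) (Hs Vs As Bs : seq P1) (S : seq poly4) :
  lines_points_ok X Hs Vs -> ACM X -> labelling_ok X As Bs ->
  S <> [::] -> {subset S <= std_gens X Hs Vs As Bs} ->
  exists (X' : seq pt) (Hs' Vs' : seq P1),
    [/\ lines_points_ok X' Hs' Vs', ACM X' &
        forall f : poly4, gen_ideal S f <-> I_W X' Hs' Vs' f].
Proof.
move=> lpX _ [nzA [nzB [sA [sB [_ [XA [XB _]]]]]]] S0 SG.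
apply: (@subset_generators CC X Hs Vs As Bs S lpX nzA nzB sA sB XA XB S0) => s /SG.
case: (X) => [|P X'] => [|sG].
  rewrite inE => /eqP->; exists 0, 0; split=> //; exact: (esym (@gen00 CC As Bs _)).
exact: (@standard_generator_shape CC As Bs (fun j => alpha (P :: X') (nth (0, 0)%R As j)) _ s sG).
Qed.
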